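(* Let $d,e\in\mathbf{N}I$. If $\mathrm{ext}(e,d):=\mathrm{ext}(R_e,R_d)=0$, then $R_d*R_e=R_{d+e}$ in $\mathcal{C}(Q)$.
   Context: $k$ is an algebraically closed field of characteristic $0$, and $Q$ is a finite quiver without oriented cycles with vertex set $I$. $\mathbf{N}I$ is the set of vectors with nonnegative integer coordinates in the free abelian group on symbols $\sigma_i$ ($i\in I$). The Euler form is $\langle d,e\rangle=\sum_{i\in I}d_ie_i-\sum_{i\to j}d_ie_j$ (second sum over all arrows of $Q$). For $d\in\mathbf{N}I$, $R_d=\bigoplus_{\alpha:i\to j}\mathrm{Hom}_k(k^{d_i},k^{d_j})$ is the affine variety of representations of $Q$ of dimension vector $d$. For $\mathcal{A}\subset R_d$, $\mathcal{B}\subset R_e$, the set $\mathcal{A}*\mathcal{B}\subset R_{d+e}$ consists of all $X\in R_{d+e}$ for which there is an exact sequence of representations $0\to N\to X\to M\to 0$ with $M\in\mathcal{A}$, $N\in\mathcal{B}$. The composition monoid $\mathcal{C}(Q)$ is the monoid, under $*$ and with unit $R_0$, generated by the $R_{\sigma_i}$, $i\in I$; all $R_d$ belong to $\mathcal{C}(Q)$. $\mathrm{hom}(R_e,R_d):=\min\{\dim_k\mathrm{Hom}_{kQ}(B,A): A\in R_d,\,B\in R_e\}$ and $\mathrm{ext}(R_e,R_d):=\mathrm{hom}(R_e,R_d)-\langle e,d\rangle$. *)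

(* Defs.v *)
From HB Require Import structures.
From mathcomp Require Import all_boot all_order all_algebra.
From mathcomp Require Import boolp classical_sets.

Set Implicit Arguments.
Unset Strict Implicit.
Unset Printing Implicit Defensive.

Import GRing.Theory.
Local Open Scope ring_scope.

Record quiver := Quiver {
  vertex : finType;
  arrow : finType;
  src : arrow -> vertex;
  tgt : arrow -> vertex }.

Arguments src {q} _.
Arguments tgt {q} _.

(* An oriented cycle is a nonempty cyclic sequence of composable arrows; loops
   are the case of length one. *)
Definition acyclic (Q : quiver) : Prop :=
  forall c : seq (arrow Q), cycle (fun a b => tgt a == src b) c -> c = [::].

Notation dimvec Q := {ffun vertex Q -> nat}.

Definition sigma (Q : quiver) (i : vertex Q) : dimvec Q :=
  [ffun j => (j == i : nat)].

Definition euler (Q : quiver) (d e : dimvec Q) : int :=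
  \sum_i (d i * e i)%:Z - \sum_(a : arrow Q) (d (src a) * e (tgt a))%:Z.

(* The space R_d. As everywhere in mxalgebra, vectors are rows, so that the
   linear map k^m -> k^n given by an m x n matrix A is u |-> u *m A; composites
   are thus written in diagrammatic order. *)
Definition rep (k : fieldType) (Q : quiver) (d : dimvec Q) : Type :=
  forall a : arrow Q, 'M[k]_(d (src a), d (tgt a)).

Definition is_hom (k : fieldType) (Q : quiver) (d e : dimvec Q)
    (X : rep k d) (Y : rep k e) (f : forall i, 'M[k]_(d i, e i)) : Prop :=
  forall a : arrow Q, X a *m f (tgt a) = f (src a) *m Y a.

(* 0 -> N -> X -> M -> 0 is exact, with maps f and g. *)
Definition exact_seq (k : fieldType) (Q : quiver) (d x e : dimvec Q)
    (N : rep k e) (X : rep k x) (M : rep k d)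
    (f : forall i, 'M[k]_(e i, x i)) (g : forall i, 'M[k]_(x i, d i)) : Prop :=
  [/\ is_hom N X f, is_hom X M g &
      forall i, [/\ row_free (f i), (f i == kermx (g i))%MS & row_full (g i)]].

(* The vector space \bigoplus_i Hom(k^(d_i), k^(e_i)), in matrix coordinates:
   mathcomp has no vectType structure on products of distinct spaces. *)
Definition homfam (k : fieldType) (Q : quiver) (d e : dimvec Q) :=
  {ffun {i : vertex Q & ('I_(d i) * 'I_(e i))%type} -> k^o}.

Definition fam_comp (k : fieldType) (Q : quiver) (d e : dimvec Q)
    (f : homfam k d e) (i : vertex Q) : 'M[k]_(d i, e i) :=
  \matrix_(p, q)
    f (Tagged (fun j : vertex Q => ('I_(d j) * 'I_(e j))%type) (p, q)).

Definition hom_defect (k : fieldType) (Q : quiver) (d e : dimvec Q)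
    (X : rep k d) (Y : rep k e) (a : arrow Q) (f : homfam k d e) :
    'M[k]_(d (src a), e (tgt a)) :=
  X a *m fam_comp f (tgt a) - fam_comp f (src a) *m Y a.

(* Hom_{kQ}(X, Y); see mem_Hom_rep. *)
Definition Hom_rep (k : fieldType) (Q : quiver) (d e : dimvec Q)
    (X : rep k d) (Y : rep k e) : {vspace homfam k d e} :=
  (\bigcap_(a : arrow Q) lker (linfun (hom_defect X Y a)))%VS.

Lemma fam_comp_linear (k : fieldType) (Q : quiver) (d e : dimvec Q) i :
  linear (fun f : homfam k d e => fam_comp f i).
Proof. by move=> c f g; apply/matrixP => p q; rewrite !mxE !ffunE. Qed.

Lemma hom_defect_linear (k : fieldType) (Q : quiver) (d e : dimvec Q)
    (X : rep k d) (Y : rep k e) (a : arrow Q) : linear (hom_defect X Y a).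
Proof.
move=> c f g; rewrite /hom_defect !fam_comp_linear mulmxDr mulmxDl.
by rewrite -scalemxAr -scalemxAl scalerBr opprD addrACA.
Qed.

HB.instance Definition _ (k : fieldType) (Q : quiver) (d e : dimvec Q)
    (X : rep k d) (Y : rep k e) (a : arrow Q) :=
  GRing.isLinear.Build k (homfam k d e) 'M[k]_(d (src a), e (tgt a)) _
    (hom_defect X Y a) (hom_defect_linear X Y a).

Lemma mem_Hom_rep (k : fieldType) (Q : quiver) (d e : dimvec Q)
    (X : rep k d) (Y : rep k e) (f : homfam k d e) :
  f \in Hom_rep X Y <-> is_hom X Y (fam_comp f).
Proof.
rewrite /Hom_rep memvE; split=> [/subv_bigcapP fP a | fP].
  have := fP a isT; rewrite -memvE memv_ker lfunE /=.
  by rewrite /hom_defect subr_eq0 => /eqP.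
apply/subv_bigcapP => a _; rewrite -memvE memv_ker lfunE /=.
by rewrite /hom_defect subr_eq0 fP.
Qed.

Lemma fam_comp_surj (k : fieldType) (Q : quiver) (d e : dimvec Q)
    (f : forall i, 'M[k]_(d i, e i)) :
  exists F : homfam k d e, forall i, fam_comp F i = f i.
Proof.
exists [ffun u : {i : vertex Q & ('I_(d i) * 'I_(e i))%type} =>
  f (tag u) (tagged u).1 (tagged u).2].
by move=> i; apply/matrixP => p q; rewrite !mxE ffunE.
Qed.

Lemma hom_dim_ex (k : fieldType) (Q : quiver) (e d : dimvec Q) :
  exists n : nat, `[< exists (B : rep k e) (A : rep k d),
                        \dim (Hom_rep B A) = n >].
Proof.
exists (\dim (Hom_rep ((fun=> 0) : rep k e) ((fun=> 0) : rep k d))).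
by apply/asboolP; exists (fun=> 0), (fun=> 0).
Qed.

(* hom(R_e, R_d), the minimum of dim Hom(B, A) over B in R_e and A in R_d *)
Definition hom (k : fieldType) (Q : quiver) (e d : dimvec Q) : nat :=
  ex_minn (hom_dim_ex k e d).

Definition ext (k : fieldType) (Q : quiver) (e d : dimvec Q) : int :=
  (hom k e d)%:Z - euler e d.

Definition star (k : fieldType) (Q : quiver) (d e : dimvec Q)
    (A : set (rep k d)) (B : set (rep k e)) : set (rep k (d + e)) :=
  [set X | exists (M : rep k d) (N : rep k e),
     [/\ A M, B N & exists f g, exact_seq N X M f g]]%classic.

Definition gset (k : fieldType) (Q : quiver) : Type :=
  {d : dimvec Q & set (rep k d)}.

Definition gR (k : fieldType) (Q : quiver) (d : dimvec Q) : gset k Q :=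
  existT (fun d => set (rep k d)) d (@setT (rep k d)).

Definition gstar (k : fieldType) (Q : quiver) (x y : gset k Q) : gset k Q :=
  existT (fun d => set (rep k d)) (projT1 x + projT1 y)
    (star (projT2 x) (projT2 y)).

Inductive in_comp (k : fieldType) (Q : quiver) : gset k Q -> Prop :=
| in_comp_unit : in_comp (gR k 0)
| in_comp_gen (i : vertex Q) : in_comp (gR k (sigma i))
| in_comp_star (x y : gset k Q) :
    in_comp x -> in_comp y -> in_comp (gstar x y).

Definition comp_monoid (k : fieldType) (Q : quiver) : Type :=
  {x : gset k Q | in_comp x}.

Definition cstar (k : fieldType) (Q : quiver) (x y : comp_monoid k Q) :
    comp_monoid k Q :=
  exist _ (gstar (proj1_sig x) (proj1_sig y))
    (in_comp_star (proj2_sig x) (proj2_sig y)).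

Lemma sub_exact (k : fieldType) (Q : quiver) (d e : dimvec Q)
    (X : rep k (d + e)) (f : forall i, 'M[k]_(e i, (d + e)%R i)) :
  (forall i, row_free (f i)) ->
  (forall a, (f (src a) *m X a <= f (tgt a))%MS) ->
  exists (M : rep k d) (N : rep k e) g, exact_seq N X M f g.
Proof.
move=> f_free f_sub.
have g_ex i : exists g : 'M[k]_((d + e)%R i, d i),
    (f i == kermx g)%MS && row_full g.
  have r : \rank (cokermx (f i)) = d i.
    by rewrite mxrank_coker (eqP (f_free i)) ffunE addnK.
  have [g gP] : exists g : 'M[k]_((d + e)%R i, d i),
      (g^T :=: (cokermx (f i))^T)%MS.
    have r' : \rank (cokermx (f i))^T = d i by rewrite mxrank_tr.
    exists (castmx (r', erefl) (row_base (cokermx (f i))^T))^T.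
    by rewrite trmxK; apply: eqmx_trans (eqmx_cast _ _) (eq_row_base _).
  have rg : \rank g = d i by rewrite -mxrank_tr gP mxrank_tr r.
  exists g; rewrite /row_full rg eqxx andbT.
  rewrite -(geq_leqif (mxrank_leqif_eq _)).
    by rewrite mxrank_ker rg (eqP (f_free i)) ffunE addKn.
  apply/sub_kermxP/trmx_inj; rewrite trmx_mul trmx0.
  have /submxP[D ->] : (g^T <= (cokermx (f i))^T)%MS by rewrite gP.
  by rewrite -mulmxA -trmx_mul mulmx_coker trmx0 mulmx0.
pose g i := xchoose (g_ex i).
have gker i : (f i == kermx (g i))%MS by case/andP: (xchooseP (g_ex i)).
have gfull i : row_full (g i) by case/andP: (xchooseP (g_ex i)).
exists (fun a => pinvmx (g (src a)) *m (X a *m g (tgt a))).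
exists (fun a => f (src a) *m X a *m pinvmx (f (tgt a))), g.
have fg0 i : f i *m g i = 0.
  by apply/sub_kermxP; case/andP: (gker i).
split=> [a|a|i]; [by rewrite mulmxKpV | | by split].
set s := src a; set h := pinvmx (g s).
have hg : h *m g s = 1%:M by rewrite mulVpmx.
have : ((g s *m h - 1%:M) <= f s)%MS.
  rewrite (eqmxP (gker s)); apply/sub_kermxP.
  by rewrite mulmxBl -mulmxA hg mulmx1 mul1mx subrr.
case/submxP=> D ED.
have /submxP[D' ED'] := f_sub a.
apply/esym/eqP; rewrite -subr_eq0 mulmxA -[X in _ - X]mul1mx -mulmxBl ED.
by rewrite mulmxA -(mulmxA D) ED' -!mulmxA fg0 !mulmx0.
Qed.

Lemma exists_sink (Q : quiver) (d : dimvec Q) (i0 : vertex Q) :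
  acyclic Q -> d i0 != 0%N ->
  exists2 i, d i != 0%N & forall a : arrow Q, src a = i -> d (tgt a) = 0%N.
Proof.
move=> hQ d0; apply: contrapT => nosink.
have nxt i : d i != 0%N -> exists a : arrow Q, (src a == i) && (d (tgt a) != 0%N).
  move=> di; apply: contrapT => na; apply: nosink; exists i => // a sa.
  by apply/eqP; apply: contraPT na => da; apply; exists a; rewrite sa eqxx.
have [a0 /andP[_ da0]] := nxt _ d0.
pose step (a : arrow Q) : arrow Q :=
  odflt a [pick b | (src b == tgt a) && (d (tgt b) != 0%N)].
have stepP a : d (tgt a) != 0%N ->
    (tgt a == src (step a)) && (d (tgt (step a)) != 0%N).
  move=> da; rewrite /step; case: pickP => [b /=|none].
    by case/andP=> /eqP-> ->; rewrite eqxx.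
  by have [b] := nxt _ da; rewrite none.
have diter m : d (tgt (iter m step a0)) != 0%N.
  by elim: m => //= m IH; case/andP: (stepP _ IH).
have /trajectP[m lt_m Em] := looping_order step a0.
set b := iter m step a0 in Em.
have [p Ep] : {p | order step a0 = (p.+1 + m)%N}.
  by exists (order step a0 - m).-1; rewrite prednK ?subn_gt0 // subnK // ltnW.
have bp : iter p.+1 step b = b by rewrite -iterD -Ep.
have /hQ : cycle (fun a b => tgt a == src b) (traject step b p.+1).
  rewrite trajectS /=; have -> : rcons (traject step (step b) p) b
      = traject step (step b) p.+1 by rewrite trajectSr -iterSr bp.
  have bd : d (tgt b) != 0%N by exact: diter.
  elim: p.+1 {Ep bp} b bd {Em} => //= n IH b bd.
  by case/andP: (stepP _ bd) => -> sd; exact: IH.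
by [].
Qed.

Lemma in_comp_gR (k : fieldType) (Q : quiver) (d : dimvec Q) :
  acyclic Q -> in_comp (gR k d).
Proof.
move=> hQ; have [n] := ubnP (\sum_i d i)%N; elim: n d => // n IH d lt_d.
have [/eqP d0|] := boolP (\sum_i d i == 0)%N.
  suff -> : d = 0 by exact: in_comp_unit.
  apply/ffunP => i; rewrite ffunE; apply/eqP.
  by move/eqP: d0; rewrite sum_nat_eq0 => /forallP/(_ i).
rewrite sum_nat_eq0 => /forallPn[i0 /= di0].
have [i di sinki] := exists_sink hQ di0.
pose d' : dimvec Q := [ffun j => (d j - sigma i j)%N].
have sig1 : sigma i i = 1%N by rewrite ffunE eqxx.
have Ed : d = d' + sigma i.
  apply/ffunP => j; rewrite !ffunE; apply/esym/subnK.
  by case: eqP => [->|]//; rewrite lt0n.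
have -> : gR k d = gstar (gR k d') (gR k (sigma i)); last first.
  apply: in_comp_star; last exact: in_comp_gen.
  apply: IH; rewrite -ltnS; apply: leq_trans lt_d; rewrite ltnS.
  rewrite [X in (_ < X)%N](bigD1 i) //= (bigD1 i) //= -addSn leq_add //.
    by rewrite !ffunE eqxx subn1 prednK // lt0n.
  by apply: leq_sum => j _; rewrite ffunE leq_subr.
rewrite Ed /gstar /=; congr existT; apply/esym/seteqP; split=> // X _.
pose f j : 'M[k]_(sigma i j, (d' + sigma i)%R j) := pid_mx (sigma i j).
have [||M [N [g ex]]] := @sub_exact k Q d' (sigma i) X f.
- move=> j; rewrite /row_free rank_pid_mx // !ffunE; exact: leq_addl.
- move=> a; have [E|ne] := eqVneq (src a) i.
    have t0 : (d' + sigma i)%R (tgt a) = 0%N by rewrite -Ed; exact: sinki.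
    suff -> : f (src a) *m X a = 0 by exact: sub0mx.
    by apply/matrixP => p q; have := ltn_ord q; rewrite {2}t0.
  suff -> : f (src a) *m X a = 0 by exact: sub0mx.
  by apply/matrixP => p; have := ltn_ord p; rewrite {2}ffunE (negPf ne).
by exists M, N; split=> //; exists f, g.
Qed.

(* R_d as an element of C(Q) *)
Definition cR (k : fieldType) (Q : quiver) (hQ : acyclic Q) (d : dimvec Q) :
    comp_monoid k Q :=
  exist _ (gR k d) (in_comp_gR k d hQ).

(* Main.v *)
Require Import Defs.
From HB Require Import structures.
From mathcomp Require Import all_boot all_order all_algebra.
From mathcomp Require Import boolp classical_sets.

Set Implicit Arguments.
Unset Strict Implicit.
Unset Printing Implicit Defensive.

Import GRing.Theory.
Local Open Scope ring_scope.

(** The point is that every X of dimension d + e has a subrepresentation of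
    dimension e; the quotient by it then exhibits X in R_d * R_e.

    Let N in R_e and M in R_d attain the minimum defining hom(R_e, R_d). The
    Euler form is the difference of the dimensions of source and target of the
    map phi |-> N phi - phi M, whose kernel is Hom(N, M); so ext = 0 says that
    this map is onto (ext0_defect_surj), that is, Ext(N, M) = 0. Hence the
    inclusion of N in X0 = N + M is unobstructed: on the line
    X_t = X0 + t (X - X0) from X0 at t = 0 to X at t = 1, it extends to a
    subrepresentation with coefficients in k[[t]], computed coefficient by
    coefficient as the graph of a map phi (solve_deformation, graph_stable).

    It remains to move from the formal neighbourhood of t = 0 to t = 1. The
    subrepresentation lives over the field K of fractions of k[[t]], and
    subspaces of fixed dimension form a projective variety, so they specialise
    along any place of K. By Chevalley's theorem (chevalley_extension) the
    evaluation at t = 1, defined on the subring k[t] of K, extends to a place of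
    K with values in k, because k is algebraically closed. Normalising
    bases along a maximal minor of dominant value (saturated_basis) and applying
    the place gives a subrepresentation of X_1 = X (specialise_subrep). *)

(** * Formal power series *)

Definition series (k : Type) : Type := nat -> k.

HB.instance Definition _ (k : Type) := gen_eqMixin (series k).
HB.instance Definition _ (k : Type) := gen_choiceMixin (series k).

Section SeriesRing.
Variable k : comNzRingType.
Implicit Types f g h : series k.

Definition series_add f g : series k := fun n => f n + g n.
Definition series_opp f : series k := fun n => - f n.
Definition series_mul f g : series k :=
  fun n => \sum_(i < n.+1) f i * g (n - i)%N.
Definition series_of_poly (p : {poly k}) : series k := fun n => p`_n.

Definition truncate (N : nat) f : {poly k} := \poly_(i < N) f i.

(** Coefficients of a product only see finitely many coefficients of the
    factors, which reduces commutativity and associativity to the case of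
    polynomials. *)
Lemma series_mul_trunc N f g n :
  (n < N)%N -> series_mul f g n = (truncate N f * truncate N g)`_n.
Proof.
move=> ltnN; rewrite coefM; apply: eq_bigr => i _; rewrite !coef_poly.
rewrite (leq_ltn_trans _ ltnN) ?(leq_ltn_trans (leq_subr i n) ltnN) //.
by rewrite -ltnS.
Qed.

Lemma series_addA : associative series_add.
Proof. by move=> f g h; apply/funext => n; apply: addrA. Qed.

Lemma series_addC : commutative series_add.
Proof. by move=> f g; apply/funext => n; apply: addrC. Qed.

Lemma series_add0 : left_id (series_of_poly 0) series_add.
Proof.
by move=> f; apply/funext => n; rewrite /series_add /series_of_poly coef0 add0r.
Qed.

Lemma series_addN : left_inverse (series_of_poly 0) series_opp series_add.
Proof.
move=> f; apply/funext => n.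
by rewrite /series_add /series_opp /series_of_poly coef0 addNr.
Qed.

HB.instance Definition _ := GRing.isZmodule.Build (series k)
  series_addA series_addC series_add0 series_addN.

Lemma series_mulC : commutative series_mul.
Proof.
move=> f g; apply/funext => n.
by rewrite !(series_mul_trunc _ _ (ltnSn n)) mulrC.
Qed.

Lemma series_mulA : associative series_mul.
Proof.
have left_nested f g h n : series_mul (series_mul f g) h n =
    (truncate n.+1 f * truncate n.+1 g * truncate n.+1 h)`_n.
  rewrite coefM; apply: eq_bigr => i _; rewrite coef_poly ltnS leq_subr.
  by rewrite (series_mul_trunc (N := n.+1)).
move=> f g h; apply/funext => n.
by rewrite series_mulC !left_nested -[in RHS]mulrA [in RHS]mulrC.
Qed.

Lemma series_mul1 : left_id (series_of_poly 1) series_mul.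
Proof.
move=> f; apply/funext => n; rewrite /series_mul big_ord_recl /series_of_poly.
rewrite coef1 mul1r subn0 big1 ?addr0 // => i _.
by rewrite coef1 mul0r.
Qed.

Lemma series_mulDl : left_distributive series_mul series_add.
Proof.
move=> f g h; apply/funext => n; rewrite /series_add /series_mul -big_split.
by apply: eq_bigr => i _; rewrite mulrDl.
Qed.

Lemma series_1neq0 : series_of_poly 1 != 0.
Proof.
apply/eqP => /(congr1 (fun f => f 0%N)) /eqP.
by rewrite /GRing.zero /= /series_of_poly coef1 coef0 oner_eq0.
Qed.

HB.instance Definition _ := GRing.Zmodule_isComNzRing.Build (series k)
  series_mulA series_mulC series_mul1 series_mulDl series_1neq0.

Lemma coef_series0 n : (0 : series k) n = 0. Proof. exact: coef0. Qed.

Lemma coef_seriesD f g n : (f + g) n = f n + g n. Proof. by []. Qed.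

Lemma coef_seriesM f g n : (f * g) n = \sum_(i < n.+1) f i * g (n - i)%N.
Proof. by []. Qed.

Lemma coef_series_sum (I : Type) (r : seq I) (P : pred I)
    (F : I -> series k) n :
  (\sum_(i <- r | P i) F i) n = \sum_(i <- r | P i) F i n.
Proof.
by elim/big_rec2: _ => [|i x y _ <-//]; apply: coef_series0.
Qed.

Lemma series_of_poly_zmod_morphism : zmod_morphism series_of_poly.
Proof. by move=> p q; apply/funext => n; rewrite /series_of_poly coefB. Qed.

Lemma series_of_poly_monoid_morphism : monoid_morphism series_of_poly.
Proof. by split=> // p q; apply/funext => n; rewrite /series_of_poly coefM. Qed.

HB.instance Definition _ := GRing.isZmodMorphism.Build {poly k} (series k)
  series_of_poly series_of_poly_zmod_morphism.
HB.instance Definition _ := GRing.isMonoidMorphism.Build {poly k} (series k)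
  series_of_poly series_of_poly_monoid_morphism.

Lemma series_of_poly_inj : injective series_of_poly.
Proof.
by move=> p q epq; apply/polyP => n; apply: (congr1 (fun f : series k => f n)).
Qed.

Lemma coef_seriesCM (c : k) f n : (series_of_poly c%:P * f) n = c * f n.
Proof.
rewrite coef_seriesM big_ord_recl /series_of_poly coefC eqxx subn0.
by rewrite big1 ?addr0 // => i _; rewrite coefC mul0r.
Qed.

Lemma coef_seriesXM f n :
  (series_of_poly 'X * f) n = if n is m.+1 then f m else 0.
Proof.
rewrite coef_seriesM big_ord_recl /series_of_poly coefX mul0r add0r.
case: n => [|n]; first by rewrite big_ord0.
rewrite big_ord_recl coefX mul1r subSS subn0 big1 ?addr0 // => i _.
by rewrite coefX mul0r.
Qed.

Definition series_unit : pred (series k) := fun f => `[< exists g, g * f = 1 >].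

Definition series_inv f : series k :=
  if pselect (exists g, g * f = 1) is left h then projT1 (cid h) else f.

Lemma series_mulVx : {in series_unit, left_inverse 1 series_inv *%R}.
Proof.
move=> f /asboolP uf; rewrite /series_inv; case: pselect => // h.
exact: (projT2 (cid h)).
Qed.

Lemma series_unitPl f g : g * f = 1 -> series_unit f.
Proof. by move=> fg1; apply/asboolP; exists g. Qed.

Lemma series_invr_out : {in [predC series_unit], series_inv =1 id}.
Proof.
move=> f /negP uf; rewrite /series_inv; case: pselect => // h.
by case: uf; apply/asboolP.
Qed.

HB.instance Definition _ := GRing.ComNzRing_hasMulInverse.Build (series k)
  series_mulVx series_unitPl series_invr_out.

End SeriesRing.

(** The coefficient of a product at the sum of the two orders is the product of
    the leading coefficients. *)
Lemma series_integral (k : idomainType) :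
  GRing.integral_domain_axiom (series k).
Proof.
have order (f : series k) : f != 0 ->
    exists2 n, f n != 0 & forall m, (m < n)%N -> f m = 0.
  move=> nzf; have exn : exists n, f n != 0.
    apply: contrapT => nf; case/negP: nzf; apply/eqP/funext => n.
    by rewrite coef_series0; apply: contrapT => /eqP ?; apply: nf; exists n.
  case: (ex_minnP exn) => n fn minn; exists n => // m ltmn.
  by apply/eqP; apply: contraLR ltmn => /minn; rewrite -leqNgt.
move=> f g fg0; apply: contrapT => /negP; rewrite negb_or.
case/andP=> /order[a fa mina] /order[b gb minb].
have /eqP := congr1 (fun h : series k => h (a + b)%N) fg0.
rewrite coef_seriesM.
have lta : (a < (a + b).+1)%N by rewrite ltnS leq_addr.
rewrite (bigD1 (Ordinal lta)) //= addKn big1 ?addr0 => [|i].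
  rewrite coef_series0 mulf_eq0.
  by rewrite (negPf fa) (negPf gb).
rewrite -val_eqE /= neq_ltn => /orP[lt_i|lt_i]; first by rewrite mina ?mul0r.
by rewrite minb ?mulr0 // ltn_subLR ?ltn_add2r // -ltnS.
Qed.

HB.instance Definition _ (k : idomainType) :=
  GRing.ComUnitRing_isIntegral.Build (series k) (@series_integral k).

(** * Places with values in an algebraically closed field *)

(** The ideal J is principal, and a generator without root would be a unit. *)
Lemma common_root (k : closedFieldType) (J : {poly k} -> Prop) :
  (forall p q, J p -> J q -> J (p - q)) -> (forall r p, J p -> J (r * p)) ->
  ~ J 1 -> exists a, forall p, J p -> p.[a] = 0.
Proof.
move=> JB JM J1.
have [exq|noq] := pselect
  (exists n, `[< exists q, [/\ J q, q != 0 & size q = n] >]).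
  case: (ex_minnP exq) => n /asboolP[q [Jq nzq szq]] minn.
  have /closed_rootP[a qa] : size q != 1%N.
    apply: contra_notN J1 => /size_poly1P[c nzc Eq].
    have -> : 1 = c^-1%:P * q by rewrite Eq -polyCM mulVf.
    exact: JM.
  exists a => p Jp; apply/eqP; apply: root_dvdp qa.
  rewrite /dvdp; apply: contrapT => /negP nzr.
  have Jr : J (p %% q).
    have -> : p %% q = p - p %/ q * q.
      by rewrite {2}[p](divp_eq p q) addrC addKr.
    by apply: JB => //; apply: JM.
  have /minn : `[< exists q', [/\ J q', q' != 0 & size q' = size (p %% q)] >].
    by apply/asboolP; exists (p %% q).
  by rewrite leqNgt -szq ltn_modp nzq.
exists 0 => p Jp.
have [->|nzp] := eqVneq p 0; first by rewrite horner0.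
by case: noq; exists (size p); apply/asboolP; exists p.
Qed.

Lemma horner_rev (R : fieldType) (N : nat) (q : {poly R}) (x : R) :
  (size q <= N.+1)%N -> x != 0 ->
  (\poly_(i < N.+1) q`_(N - i)).[x] = x ^+ N * q.[x^-1].
Proof.
move=> szq nzx; rewrite horner_poly (horner_coef_wide _ szq) big_distrr /=.
rewrite (reindex_inj rev_ord_inj); apply: eq_bigr => i _ /=.
have lti : (i <= N)%N by rewrite -ltnS.
by rewrite subSS subKn // mulrCA expfB_cond ?exprVn // (negPf nzx).
Qed.

(** A ring homomorphism to k defined on a subring of K, encoded as its graph.
    Extension of homomorphisms is then inclusion of subrings of K * k, and a
    polynomial over K * k carries its coefficients together with their
    values. *)
Record partial_hom (K k : fieldType) (G : set (K * k)) : Prop := PartialHom {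
  phom1 : G 1;
  phomB : forall u v, G u -> G v -> G (u - v);
  phomM : forall u v, G u -> G v -> G (u * v);
  phom0 : forall y, G (0, y) -> y = 0 }.

Section PartialHom.
Variables (K k : fieldType) (G : set (K * k)).
Hypothesis hG : partial_hom G.

Lemma phom_zero : G 0.
Proof. by rewrite -(subrr 1); apply: phomB (phom1 hG) (phom1 hG). Qed.

Lemma phomD u v : G u -> G v -> G (u + v).
Proof.
move=> Gu Gv; rewrite -[v]opprK -[- v]sub0r.
by apply: phomB => //; apply: phomB => //; apply: phom_zero.
Qed.

Lemma phom_sum (I : Type) (r : seq I) (P : pred I) (F : I -> K * k) :
  (forall i, P i -> G (F i)) -> G (\sum_(i <- r | P i) F i).
Proof.
by move=> GF; elim/big_ind: _ => //; [exact: phom_zero|exact: phomD].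
Qed.

Lemma phom_fun x y y' : G (x, y) -> G (x, y') -> y = y'.
Proof.
move=> Gy Gy'; apply/eqP; rewrite -subr_eq0; apply/eqP; apply: (phom0 hG).
rewrite -[X in (X, _)](subrr x); have := phomB hG Gy Gy'; by [].
Qed.

Definition phom_poly (p : {poly K * k}) : Prop := forall i, G p`_i.

Lemma phom_polyB p q : phom_poly p -> phom_poly q -> phom_poly (p - q).
Proof. by move=> Gp Gq i; rewrite coefB; apply: phomB. Qed.

Lemma phom_polyM p q : phom_poly p -> phom_poly q -> phom_poly (p * q).
Proof.
by move=> Gp Gq i; rewrite coefM; apply: phom_sum => j _; apply: phomM.
Qed.

Lemma phom_polyC u : G u -> phom_poly u%:P.
Proof. by move=> Gu i; rewrite coefC; case: eqP => // _; apply: phom_zero. Qed.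

Lemma phom_polyX : phom_poly 'X.
Proof.
move=> i; rewrite coefX; case: eqP => _; [exact: phom1|exact: phom_zero].
Qed.

(** A relation p(x) = 0 whose coefficients reduce to those of 1 says that x
    takes the value infinity. If x and its inverse both satisfied one, the
    leading term of the longer relation could be cancelled by the reversal of
    the shorter one, down to the constant relation 1 = 0. *)
Lemma not_both_infinite (x : K) p q : x != 0 ->
  phom_poly p -> map_poly snd p = 1 -> (map_poly fst p).[x] = 0 ->
  phom_poly q -> map_poly snd q = 1 -> (map_poly fst q).[x^-1] = 0 -> False.
Proof.
have [N] := ubnP (size p + size q)%N; elim: N x p q => // N IH x p q.
wlog leqp : x p q / (size q <= size p)%N.
  move=> wh; have [|/ltnW] := leqP (size q) (size p); first exact: wh.
  rewrite addnC => leqp ltN nzx Gp p1 px Gq q1 qx.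
  by apply: (wh x^-1 q p) => //; rewrite ?invr_eq0 ?invrK.
move=> ltN nzx Gp p1 px Gq q1 qx.
have nz_size (u : {poly K * k}) : map_poly snd u = 1 -> (0 < size u)%N.
  rewrite size_poly_gt0; apply: contra_eq_neq => ->.
  by rewrite rmorph0 eq_sym oner_eq0.
have [n szp] : {n | size p = n.+1}.
  by exists (size p).-1; rewrite prednK ?nz_size.
have [r szq] : {r | size q = r.+1}.
  by exists (size q).-1; rewrite prednK ?nz_size.
have lern : (r <= n)%N by rewrite szp szq in leqp.
have snd1 (u : {poly K * k}) i : map_poly snd u = 1 -> (u`_i).2 = (i == 0)%:R.
  by move=> u1; rewrite -coef1 -u1 coef_map.
have n_gt0 : (0 < n)%N.
  rewrite lt0n; apply/negP => /eqP n0; rewrite n0 in szp.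
  have /size_poly1P[[a b] _ Ep] : size p == 1%N by rewrite szp.
  move: px p1; rewrite Ep !map_polyC /= hornerC => a0 /polyC_inj b1.
  have := Gp 0%N; rewrite Ep coefC eqxx a0 => /(phom0 hG)/eqP.
  by rewrite b1 oner_eq0.
pose q' : {poly K * k} := \poly_(i < r.+1) q`_(r - i).
(* The factor q`_0 reduces to 1 and p`_n to 0, so that p' still reduces to 1. *)
pose p' := (q`_0)%:P * p - (p`_n)%:P * ('X^(n - r) * q').
have Gq' : phom_poly q'.
  by move=> i; rewrite coef_poly; case: ifP => // _; apply: phom_zero.
have q'x : (map_poly fst q').[x] = 0.
  have -> : map_poly fst q' = \poly_(i < r.+1) (map_poly fst q)`_(r - i).
    have coef_fst (u : {poly K * k}) i : (map_poly fst u)`_i = (u`_i).1.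
      by rewrite coef_map.
    apply/polyP => i; rewrite coef_fst [in RHS]coef_poly coef_fst coef_poly.
    by case: ifP.
  rewrite horner_rev ?qx ?mulr0 // -szq; exact: size_poly.
apply: (IH x p' q) => //.
- rewrite -ltnS; apply: leq_trans ltN; rewrite ltnS ltn_add2r szp ltnS.
  apply/leq_sizeP => j lenj; rewrite coefB !coefCM coefXnM coef_poly.
  rewrite ltnNge (leq_trans (leq_subr _ _) lenj) /=.
  rewrite ltnS leq_subLR subnK //; case: ltngtP lenj => // [ltnj|<-] _.
    by rewrite [p`_j]nth_default ?szp // !mulr0 subrr.
  by rewrite subKn // subnn mulrC subrr.
- move=> i; rewrite coefB !coefCM coefXnM; apply: phomB => //.
    exact: phomM.
  apply: phomM => //; case: ifP => // _; exact: phom_zero.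
- rewrite rmorphB !rmorphM /= !map_polyC /= p1 snd1 // (snd1 p) //.
  by rewrite (gtn_eqF n_gt0) eqxx mulr1 mul0r subr0.
- by rewrite rmorphB !rmorphM /= hornerD hornerN !hornerM px q'x !mulr0 subrr.
Qed.

End PartialHom.

(** Chevalley's extension theorem. For a maximal extension, x can fail to have
    a value only if the reductions of the polynomial relations satisfied by x
    have no common root in k, hence if one of these relations reduces to 1; this
    cannot happen for both x and its inverse. *)
Lemma chevalley_extension (K : fieldType) (k : closedFieldType)
    (G0 : set (K * k)) :
  partial_hom G0 -> (forall c, exists a, G0 (a, c)) ->
  exists G, [/\ partial_hom G, (G0 `<=` G)%classic &
    forall x, x != 0 -> (exists y, G (x, y)) \/ (exists y, G (x^-1, y))].
Proof.
move=> hG0 surj0.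
(* The union of the empty chain is empty, hence the case of the empty graph. *)
pose P (G : set (K * k)) := G = set0 \/ ((G0 `<=` G)%classic /\ partial_hom G).
have [G [[G0E|[G0G hG]] maxG]] :
    exists A, P A /\ forall B, (A `<` B)%classic -> ~ P B.
- apply: Zorn_bigcup => F FP totF.
  have [F0|/existsNP[A /not_implyP[FA nzA]]] :=
      pselect (forall A, F A -> A = set0).
    by left; apply/seteqP; split=> // u [A FA Au]; rewrite (F0 A FA) in Au.
  have PF B u : F B -> B u -> (G0 `<=` B)%classic /\ partial_hom B.
    by move=> FB Bu; case: (FP B FB) => // B0; rewrite B0 in Bu.
  have [G0A hA] : (G0 `<=` A)%classic /\ partial_hom A by case: (FP A FA).
  have join u v : (\bigcup_(X in F) X)%classic u ->
      (\bigcup_(X in F) X)%classic v ->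
      exists B, [/\ F B, partial_hom B, B u & B v].
    move=> [B FB Bu] [C FC Cv].
    have [BC|CB] := totF B C FB FC.
      by exists C; split=> //; [case: (PF C v) | apply: BC].
    by exists B; split=> //; [case: (PF B u) | apply: CB].
  right; split; first by move=> u G0u; exists A => //; apply: G0A.
  split.
  + by exists A => //; apply: phom1.
  + move=> u v Fu /(join _ _ Fu)[B [FB hB Bu Bv]]; exists B => //.
    exact: phomB.
  + move=> u v Fu /(join _ _ Fu)[B [FB hB Bu Bv]]; exists B => //.
    exact: phomM.
  + by move=> y Fy; have [B [_ hB By _]] := join _ _ Fy Fy; apply: (phom0 hB).
- case: (maxG G0); last by right; split.
  rewrite G0E; split=> // /(_ _ (phom1 hG0)); exact.
exists G; split=> // x nzx.
pose J z (q : {poly k}) := exists p : {poly K * k},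
  [/\ phom_poly G p, map_poly snd p = q & (map_poly fst p).[z] = 0].
have surj c : exists a, G (a, c) by have [a /G0G] := surj0 c; exists a.
have lift (q : {poly k}) :
    exists2 p : {poly K * k}, phom_poly G p & map_poly snd p = q.
  elim/poly_ind: q => [|q c [p Gp pq]].
    by exists 0; [move=> i; rewrite coef0; apply: phom_zero | rewrite rmorph0].
  have [a Ga] := surj c; exists (p * 'X + (a, c)%:P).
    have GpX : phom_poly G (p * 'X).
      by apply: phom_polyM => //; apply: phom_polyX.
    by move=> i; rewrite coefD; apply: phomD => //; apply: phom_polyC.
  by rewrite rmorphD rmorphM /= map_polyX map_polyC /= pq.
have finite_or_infinite z : ~ J z 1 -> exists y, G (z, y).
  move=> J1; have [a Ja] : exists a, forall p, J z p -> p.[a] = 0.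
    apply: common_root J1 => [_ q' [p [Gp <- pz]]|r _ [p [Gp <- pz]]].
      case=> q [Gq <- qz]; exists (p - q); split.
      - exact: phom_polyB.
      - by rewrite rmorphB.
      - by rewrite rmorphB hornerD hornerN pz qz subrr.
    have [s Gs <-] := lift r.
    exists (s * p); split; [exact: phom_polyM | by rewrite rmorphM |].
    by rewrite rmorphM hornerM pz mulr0.
  pose G' : set (K * k) :=
    [set u | exists2 p, phom_poly G p & u = p.[(z, a)]]%classic.
  have GG' : (G `<=` G')%classic.
    by move=> u Gu; exists u%:P; [apply: phom_polyC | rewrite hornerC].
  have G'z : G' (z, a) by exists 'X; [apply: phom_polyX | rewrite hornerX].
  have hG' : partial_hom G'.
    split.
    + by apply: GG'; apply: phom1.
    + move=> _ _ [p Gp ->] [q Gq ->]; exists (p - q); first exact: phom_polyB.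
      by rewrite hornerD hornerN.
    + move=> _ _ [p Gp ->] [q Gq ->]; exists (p * q); first exact: phom_polyM.
      by rewrite hornerM.
    + move=> y [p Gp Ep]; have := Ja (map_poly snd p).
      rewrite -[a]/((z, a).2) horner_map -Ep /= => -> //.
      by exists p; split=> //; rewrite -[z]/((z, a).1) horner_map -Ep.
  exists a; apply: contrapT => nGz; case: (maxG G') => //.
    by split=> // /(_ _ G'z).
  by right; split=> //; apply: subset_trans GG'.
have [Jx|/finite_or_infinite] := pselect (J x 1); last by left.
right; apply: finite_or_infinite => Jx'.
have [p [Gp p1 px]] := Jx; have [q [Gq q1 qx]] := Jx'.
exact: (not_both_infinite hG nzx Gp p1 px Gq q1 qx).
Qed.

(** * Specialisation of subspaces along a place *)

(** In a matrix with an identity block, every entry is a maximal minor. *)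
Lemma det_replace_col (R : comNzRingType) (m n : nat) (c : 'I_m -> 'I_n)
    (h : 'M[R]_(m, n)) (p : 'I_m) (q : 'I_n) :
  colsub c h = 1%:M ->
  \det (colsub (fun j => if j == p then q else c j) h) = h p q.
Proof.
move=> ch1; have ch i j : h i (c j) = (i == j)%:R.
  by have /matrixP/(_ i j) := ch1; rewrite !mxE.
rewrite (expand_det_row _ p) (bigD1 p) //= mxE eqxx big1 ?addr0 => [|j nejp].
  rewrite /cofactor -signr_odd addnn odd_double expr0 mul1r.
  set A := row' _ _; suff -> : A = 1%:M by rewrite det1 mulr1.
  apply/matrixP => i j; rewrite !mxE eq_sym (negPf (neq_lift _ _)) ch.
  by rewrite (inj_eq lift_inj).
by rewrite mxE (negPf nejp) ch eq_sym (negPf nejp) mul0r.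
Qed.

Section Specialisation.
Variables (K k : fieldType) (G : set (K * k)).
Hypothesis hG : partial_hom G.
Hypothesis valG :
  forall x, x != 0 -> (exists y, G (x, y)) \/ (exists y, G (x^-1, y)).

(** Divisibility in a valuation ring is total, so a finite family has a member
    dividing all the others. *)
Lemma exists_dominant (I : finType) (F : I -> K) :
  (exists i, F i != 0) ->
  exists2 i, F i != 0 & forall j, exists y, G (F j / F i, y).
Proof.
case=> i0 nzi0.
suff [i nzi domi] : exists2 i, F i != 0 &
    forall j, j \in i0 :: enum I -> exists y, G (F j / F i, y).
  by exists i => // j; apply: domi; rewrite inE mem_enum orbT.
elim: (enum I) => [|j s [i nzi domi]].
  exists i0 => // j; rewrite inE => /eqP->; exists 1; rewrite divff //.
  exact: phom1 hG.
have [j0|nzj] := eqVneq (F j) 0.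
  exists i => // l; rewrite !inE orbCA => /orP[/eqP->|]; last exact: domi.
  by exists 0; rewrite j0 mul0r; apply: phom_zero hG.
have [ji|[y ij]] := valG (mulf_neq0 nzj (invr_neq0 nzi)).
  by exists i => // l; rewrite !inE orbCA => /orP[/eqP->|]; last exact: domi.
rewrite invfM invrK mulrC in ij.
exists j => // l; rewrite !inE orbCA => /orP[/eqP->|/domi[z li]].
  by exists 1; rewrite divff //; apply: phom1 hG.
have -> : F l / F j = F l / F i * (F i / F j) by rewrite mulrA divfK.
by exists (z * y); apply: (phomM hG li ij).
Qed.

(** After normalisation along a dominant maximal minor of f, every entry is the
    quotient of another maximal minor by that one, hence has a value. The
    identity block ensures that the reduction keeps the same rank. *)
Lemma saturated_basis (m n : nat) (f : 'M[K]_(m, n)) : row_free f ->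
  exists (h : 'M[K]_(m, n)) (c : 'I_m -> 'I_n),
    [/\ (h :=: f)%MS, colsub c h = 1%:M & forall p q, exists y, G (h p q, y)].
Proof.
move=> f_free; pose F (c : {ffun 'I_m -> 'I_n}) := \det (colsub c f).
have [|c nzc domc] := @exists_dominant _ F.
  have fT : row_full f^T by rewrite /row_full mxrank_tr.
  exists (fullrankfun fT); rewrite /F -unitfE -det_tr -unitmxE -row_full_unit.
  by rewrite /row_full trmx_mxsub mxrank_fullrowsub.
have uA : colsub c f \in unitmx by rewrite unitmxE unitfE.
pose h := invmx (colsub c f) *m f; exists h, c.
have minor_h c' : \det (colsub c' h) = F [ffun j => c' j] / F c.
  rewrite /h -mulmx_colsub det_mulmx det_inv mulrC; congr (_ / _).
  by congr (\det _); apply: eq_colsub => j; rewrite ffunE.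
split.
- apply: eqmxMfull; rewrite row_full_unit unitmx_inv.
  exact: uA.
- by rewrite -mulmx_colsub mulVmx.
- move=> p q; rewrite -(@det_replace_col _ _ _ c h p q) ?minor_h //.
  by rewrite -mulmx_colsub mulVmx.
Qed.

Definition reduces_to (m n : nat) (A : 'M[K]_(m, n)) (B : 'M[k]_(m, n)) :=
  forall p q, G (A p q, B p q).

Lemma reduces_toM (m n p : nat) A A' B B' :
  reduces_to A A' -> reduces_to B B' ->
  reduces_to (A *m B : 'M_(m, p)) (A' *m (B' : 'M_(n, p))).
Proof.
move=> AA' BB' i j; rewrite !mxE.
apply: (big_ind2 (fun x y => G (x, y))); first exact: phom_zero hG.
  by move=> x y x' y' xy xy'; have := phomD hG xy xy'.
by move=> l _; have := phomM hG (AA' i l) (BB' l j).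
Qed.

Lemma reduces_to_inj (m n : nat) (A : 'M_(m, n)) B B' :
  reduces_to A B -> reduces_to A B' -> B = B'.
Proof.
by move=> AB AB'; apply/matrixP => p q; apply: (phom_fun hG (AB p q) (AB' p q)).
Qed.

(** This is the valuative criterion of properness for quiver Grassmannians. *)
Lemma specialise_subrep (Q : quiver) (x e : dimvec Q) (X : rep K x)
    (X' : rep k x) (f : forall i, 'M[K]_(e i, x i)) :
  (forall a, reduces_to (X a) (X' a)) ->
  (forall i, row_free (f i)) ->
  (forall a, (f (src a) *m X a <= f (tgt a))%MS) ->
  exists f' : forall i, 'M[k]_(e i, x i),
    (forall i, row_free (f' i)) /\
    (forall a, (f' (src a) *m X' a <= f' (tgt a))%MS).
Proof.
move=> XX' f_free f_sub.
have basis_ex i : exists u : 'M[K]_(e i, x i) * 'M[k]_(e i, x i) *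
                              {ffun 'I_(e i) -> 'I_(x i)},
    [/\ (u.1.1 :=: f i)%MS, colsub u.2 u.1.1 = 1%:M & reduces_to u.1.1 u.1.2].
  have [h [c [hf ch hG']]] := saturated_basis (f_free i).
  pose h' := \matrix_(p, q) projT1 (cid (hG' p q)).
  exists (h, h', [ffun j => c j]); split=> //=.
    by rewrite -ch; apply: eq_colsub => j; rewrite ffunE.
  by move=> p q; rewrite mxE; case: cid.
pose u i := projT1 (cid (basis_ex i)).
have uP i : [/\ ((u i).1.1 :=: f i)%MS, colsub (u i).2 (u i).1.1 = 1%:M
                & reduces_to (u i).1.1 (u i).1.2] by rewrite /u; case: cid.
have one' i : colsub (u i).2 (u i).1.2 = 1%:M.
  have [_ ch hh'] := uP i; apply: (@reduces_to_inj _ _ 1%:M).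
    by rewrite -ch => p q; rewrite !mxE; apply: hh'.
  move=> p q; rewrite !mxE.
  by case: eqP => _; [exact: phom1 hG|exact: phom_zero hG].
exists (fun i => (u i).1.2); split=> [i|a].
  apply/row_freeP; exists (colsub (u i).2 1%:M).
  by rewrite mulmx_colsub mulmx1.
have [hs _ hs'] := uP (src a); have [ht cht ht'] := uP (tgt a).
set hS := (u (src a)).1.1 in hs hs' *.
set hT := (u (tgt a)).1.1 in ht ht' cht *.
set c := (u (tgt a)).2 in cht.
have /submxP[P EP] : (hS *m X a <= hT)%MS.
  by rewrite ht; apply: submx_trans (f_sub a); rewrite submxMr // hs.
(* The coefficients of the expansion in the normalised basis are themselves
   entries of hS *m X a, hence lie in the valuation ring. *)
have P_sub : P = colsub c (hS *m X a).
  by rewrite EP -mulmx_colsub cht mulmx1.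
have red := reduces_toM hs' (XX' a).
suff -> : (u (src a)).1.2 *m X' a =
    colsub c ((u (src a)).1.2 *m X' a) *m (u (tgt a)).1.2 by exact: submxMl.
apply: (reduces_to_inj red); rewrite EP; apply: reduces_toM ht'.
by rewrite P_sub => p q; rewrite ![colsub _ _ _ _]mxE; apply: red.
Qed.

End Specialisation.

(** * Vanishing of ext *)

Lemma dim_ffun_regular (k : fieldType) (I : finType) :
  \dim {:{ffun I -> k^o}} = #|I|.
Proof. by rewrite dimvf /dim /= muln1. Qed.

Lemma card_tagged_prod (I : finType) (m n : I -> nat) :
  #|{: {i : I & ('I_(m i) * 'I_(n i))%type}}| = (\sum_i m i * n i)%N.
Proof.
rewrite card_tagged sumnE big_map big_enum.
by apply: eq_bigr => i _; rewrite card_prod !card_ord.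
Qed.

(** The Euler form is the difference between the dimensions of the source and
    of the target of the defect map, whose kernel is Hom(N, M); when N and M
    attain the minimum of dim Hom, ext = 0 leaves no room for a cokernel. *)
Lemma ext0_defect_surj (k : fieldType) (Q : quiver) (d e : dimvec Q) :
  ext k e d = 0 ->
  exists (N : rep k e) (M : rep k d), forall W,
    exists phi : homfam k e d, forall a, hom_defect N M a phi = W a.
Proof.
have [N [M dimH]] : exists (N : rep k e) (M : rep k d),
    \dim (Hom_rep N M) = Defs.hom k e d.
  by rewrite /Defs.hom; case: (ex_minnP (hom_dim_ex k e d)) => n /asboolP.
move/eqP; rewrite /ext subr_eq0 => /eqP ext0; exists N, M => W.
pose T := {a : arrow Q & ('I_(e (src a)) * 'I_(d (tgt a)))%type}.
(* The defects at all arrows, as one linear map to a space of coordinates. *)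
pose D (phi : homfam k e d) : {ffun T -> k^o} :=
  [ffun u => hom_defect N M (tag u) phi (tagged u).1 (tagged u).2].
have D_lin : linear D.
  move=> c f g; apply/ffunP => u; rewrite !ffunE.
  by rewrite hom_defect_linear !mxE.
pose DL : {linear homfam k e d -> {ffun T -> k^o}} :=
  HB.pack D (GRing.isLinear.Build k _ _ _ D D_lin).
have kerD : lker (linfun DL) = Hom_rep N M.
  apply/vspaceP => phi; apply/idP/idP.
    rewrite memv_ker lfunE /= => /eqP/ffunP D0; apply/mem_Hom_rep => a.
    apply/eqP; rewrite -subr_eq0; apply/eqP/matrixP => p q.
    have := D0 (Tagged
      (fun a => ('I_(e (src a)) * 'I_(d (tgt a)))%type) (p, q)).
    by rewrite !ffunE /= => ->; rewrite mxE.
  move/mem_Hom_rep => homphi; rewrite memv_ker lfunE /=.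
  by apply/eqP/ffunP => u; rewrite !ffunE /hom_defect homphi subrr mxE.
have := limg_ker_dim (linfun DL) fullv.
rewrite capfv kerD dimH dim_ffun_regular card_tagged_prod => dimE.
have imgD : limg (linfun DL) = fullv.
  apply/eqP; rewrite eqEdim subvf dim_ffun_regular card_tagged_prod /=.
  rewrite -(leq_add2l (Defs.hom k e d)) dimE leq_eqVlt.
  rewrite -eqz_nat PoszD ext0 /euler !(big_morph Posz PoszD (erefl _)).
  by rewrite subrK eqxx.
have : [ffun u : T => W (tag u) (tagged u).1 (tagged u).2] \in limg (linfun DL).
  by rewrite imgD; apply: memvf.
case/memv_imgP => phi _; rewrite lfunE => /= /ffunP Dphi.
exists phi => a; apply/matrixP => p q.
have := Dphi (Tagged (fun a => ('I_(e (src a)) * 'I_(d (tgt a)))%type) (p, q)).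
by rewrite !ffunE.
Qed.

(** * Deforming a subrepresentation over power series *)

(** If the first n + 1 values of T f depend only on the first n values of f,
    iterating T from anywhere makes the values stationary one after another. *)
Lemma causal_fixpoint (V : Type) (T : (nat -> V) -> nat -> V) (f0 : nat -> V) :
  (forall n f g, (forall j, (j < n)%N -> f j = g j) ->
     forall j, (j < n.+1)%N -> T f j = T g j) ->
  exists f, forall n, T f n = f n.
Proof.
move=> causalT.
have stab n m j : (j < n)%N -> (n <= m)%N -> iter n T f0 j = iter m T f0 j.
  elim: n m j => // n IH [//|m] j ltj lenm /=.
  by apply: causalT ltj => l ltl; apply: IH.
exists (fun n => iter n.+1 T f0 n) => n.
by apply: (causalT n) => // j ltj; apply: stab.
Qed.

Section SeriesMatrices.
Variable k : comNzRingType.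

Definition const_series : {rmorphism k -> series k} :=
  @series_of_poly k \o @polyC k.

Definition coefmx (n m p : nat) (A : 'M[series k]_(m, p)) : 'M[k]_(m, p) :=
  \matrix_(i, j) A i j n.

(** Congruence modulo the n-th power of the variable. *)
Definition congmx (n m p : nat) (A B : 'M[series k]_(m, p)) : Prop :=
  forall j, (j < n)%N -> coefmx j A = coefmx j B.

Lemma congmx_refl n m p (A : 'M_(m, p)) : congmx n A A. Proof. by []. Qed.

Lemma congmxD n m p (A A' B B' : 'M_(m, p)) :
  congmx n A A' -> congmx n B B' -> congmx n (A + B) (A' + B').
Proof.
move=> AA' BB' l ltl; apply/matrixP => i j.
have /matrixP/(_ i j) := AA' l ltl; have /matrixP/(_ i j) := BB' l ltl.
by rewrite !mxE !coef_seriesD => -> ->.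
Qed.

Lemma congmxM n m p q (A A' : 'M_(m, p)) (B B' : 'M_(p, q)) :
  congmx n A A' -> congmx n B B' -> congmx n (A *m B) (A' *m B').
Proof.
move=> AA' BB' l ltl; apply/matrixP => i j; rewrite !mxE !coef_series_sum.
apply: eq_bigr => h _; rewrite !coef_seriesM; apply: eq_bigr => [[u /= ltu] _].
have ltun : (u < n)%N by apply: leq_ltn_trans ltl; rewrite -ltnS.
have ltlun : (l - u < n)%N by apply: leq_ltn_trans ltl; apply: leq_subr.
have /matrixP/(_ i h) := AA' u ltun; have /matrixP/(_ h j) := BB' _ ltlun.
by rewrite !mxE => -> ->.
Qed.

Lemma congmxN n m p (A A' : 'M_(m, p)) : congmx n A A' -> congmx n (- A) (- A').
Proof.
move=> AA'; rewrite -[- A]mul1mx -[- A']mul1mx !mulmxN -!mulNmx.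
by apply: congmxM.
Qed.

Lemma coefmxB n m p (A B : 'M_(m, p)) :
  coefmx n (A - B) = coefmx n A - coefmx n B.
Proof. by apply/matrixP => i j; rewrite !mxE. Qed.

Lemma coefmx_mul_const n m p q (A : 'M[k]_(m, p)) (B : 'M_(p, q)) :
  coefmx n (map_mx const_series A *m B) = A *m coefmx n B.
Proof.
apply/matrixP => i j; rewrite !mxE coef_series_sum; apply: eq_bigr => l _.
by rewrite !mxE /= coef_seriesCM.
Qed.

Lemma coefmx_const_mul n m p q (A : 'M_(m, p)) (B : 'M[k]_(p, q)) :
  coefmx n (A *m map_mx const_series B) = coefmx n A *m B.
Proof.
apply/matrixP => i j; rewrite !mxE coef_series_sum; apply: eq_bigr => l _.
by rewrite !mxE /= mulrC coef_seriesCM mulrC.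
Qed.

Lemma coefmx_mulX n m p (A : 'M_(m, p)) :
  coefmx n (series_of_poly 'X *: A) = if n is n'.+1 then coefmx n' A else 0.
Proof.
apply/matrixP => i j; rewrite !mxE coef_seriesXM.
by case: n => [|n]; rewrite !mxE.
Qed.

Lemma coefmx_inj m p (A B : 'M_(m, p)) :
  (forall n, coefmx n A = coefmx n B) -> A = B.
Proof.
move=> AB; apply/matrixP => i j; apply/funext => n.
by have /matrixP/(_ i j) := AB n; rewrite !mxE.
Qed.

End SeriesMatrices.

(** Unobstructedness makes the equation solvable coefficient by coefficient:
    the factor t on the right means that the next coefficient of phi only has
    to solve a linear equation in terms of the previous ones. *)
Lemma solve_deformation (k : fieldType) (Q : quiver) (d e : dimvec Q)
    (N : rep k e) (M : rep k d)
    (rhs : (forall i, 'M[series k]_(e i, d i)) ->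
       forall a : arrow Q, 'M[series k]_(e (src a), d (tgt a))) :
  (forall W, exists phi : homfam k e d, forall a, hom_defect N M a phi = W a) ->
  (forall n phi psi, (forall i, congmx n (phi i) (psi i)) ->
     forall a, congmx n (rhs phi a) (rhs psi a)) ->
  exists phi, forall a,
    map_mx (const_series k) (N a) *m phi (tgt a)
      - phi (src a) *m map_mx (const_series k) (M a)
    = series_of_poly 'X *: rhs phi a.
Proof.
move=> surj causal.
pose S W := projT1 (cid (surj W)).
have SP W a : hom_defect N M a (S W) = W a by rewrite /S; case: cid.
pose ser (c : nat -> homfam k e d) i : 'M[series k]_(e i, d i) :=
  \matrix_(p, q) (fun n => fam_comp (c n) i p q).
have coef_ser c i n : coefmx n (ser c i) = fam_comp (c n) i.
  by apply/matrixP => p q; rewrite !mxE.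
pose T (c : nat -> homfam k e d) n :=
  if n is n'.+1 then S (fun a => coefmx n' (rhs (ser c) a)) else 0.
have [|c cE] := @causal_fixpoint _ T (fun=> 0).
  move=> n f g fg [|j] //= ltj; congr S.
  apply: functional_extensionality_dep => a.
  apply: (causal n _ _ _ a j ltj) => i l ltl.
  by rewrite !coef_ser fg.
exists (ser c) => a; apply: coefmx_inj => n.
rewrite coefmxB coefmx_mul_const coefmx_const_mul coefmx_mulX !coef_ser.
rewrite -/(hom_defect N M a (c n)) -cE; case: n => [|n] /=; last exact: SP.
exact: (linear0 (hom_defect N M a)).
Qed.

(** A splitting of R^n as R^m + R^p. Carrying the four structure maps avoids
    casts along the equality n = m + p, which holds only propositionally for the
    coordinates of a sum of dimension vectors. *)
Record frame (R : comNzRingType) (m p n : nat) := Frame {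
  sub : 'M[R]_(m, n);
  sub_proj : 'M[R]_(n, m);
  quo : 'M[R]_(p, n);
  quo_proj : 'M[R]_(n, p);
  sub_subK : sub *m sub_proj = 1%:M;
  sub_quo0 : sub *m quo_proj = 0;
  quo_sub0 : quo *m sub_proj = 0;
  quo_quoK : quo *m quo_proj = 1%:M;
  frame_sum : sub_proj *m sub + quo_proj *m quo = 1%:M }.

Definition frame_of_sum (R : comNzRingType) (m p n : nat)
    (mpn : (m + p = n)%N) : frame R m p n.
Proof.
case: n / mpn.
refine (@Frame R m p (m + p) (row_mx 1%:M 0) (col_mx 1%:M 0)
  (row_mx 0 1%:M) (col_mx 0 1%:M) _ _ _ _ _).
1-4: by rewrite mul_row_col !(mulmx0, mul0mx, mulmx1, mul1mx, addr0, add0r).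
rewrite !mul_col_row add_block_mx.
by rewrite !(mulmx0, mul0mx, mulmx1, mul1mx, addr0, add0r) -scalar_mx_block.
Defined.

Definition map_frame (R S : comNzRingType) (g : {rmorphism R -> S})
    (m p n : nat) (f : frame R m p n) : frame S m p n.
Proof.
refine (@Frame S m p n (map_mx g (sub f)) (map_mx g (sub_proj f))
  (map_mx g (quo f)) (map_mx g (quo_proj f)) _ _ _ _ _); rewrite -?map_mxM.
- by rewrite sub_subK map_mx1.
- by rewrite sub_quo0 map_mx0.
- by rewrite quo_sub0 map_mx0.
- by rewrite quo_quoK map_mx1.
- by rewrite -map_mxD frame_sum map_mx1.
Defined.

Definition graph (R : comNzRingType) (m p n : nat) (f : frame R m p n)
  (phi : 'M[R]_(m, p)) : 'M[R]_(m, n) := sub f + phi *m quo f.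

Definition dsum_mx (R : comNzRingType) (m1 p1 n1 m2 p2 n2 : nat)
    (s : frame R m1 p1 n1) (t : frame R m2 p2 n2)
    (N : 'M[R]_(m1, m2)) (M : 'M[R]_(p1, p2)) : 'M[R]_(n1, n2) :=
  sub_proj s *m N *m sub t + quo_proj s *m M *m quo t.

Lemma graph_sub_proj (R : comNzRingType) (m p n : nat) (f : frame R m p n) phi :
  graph f phi *m sub_proj f = 1%:M.
Proof. by rewrite mulmxDl -mulmxA quo_sub0 mulmx0 addr0 sub_subK. Qed.

(** Stability of the graphs of phi and psi means that the quotient component of
    the image of a vector is the image by psi of its sub component. For a direct
    sum of maps this is the linear equation N psi = phi M, so the quadratic
    terms in the entries of phi and psi all come with the factor c. *)
Lemma graph_stable (R : comNzRingType) (m1 p1 n1 m2 p2 n2 : nat)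
    (s : frame R m1 p1 n1) (t : frame R m2 p2 n2)
    (N : 'M[R]_(m1, m2)) (M : 'M[R]_(p1, p2)) (Y : 'M[R]_(n1, n2)) (c : R)
    (phi : 'M[R]_(m1, p1)) (psi : 'M[R]_(m2, p2)) :
  N *m psi - phi *m M =
    c *: (graph s phi *m Y *m quo_proj t
          - graph s phi *m Y *m sub_proj t *m psi) ->
  let X := dsum_mx s t N M + c *: Y in
  graph s phi *m X = (graph s phi *m X *m sub_proj t) *m graph t psi.
Proof.
move=> eqphi X; set Z := graph s phi *m X.
have quo_graph : graph s phi *m quo_proj s = phi.
  by rewrite mulmxDl -mulmxA sub_quo0 quo_quoK mulmx1 add0r.
have EZ : Z = N *m sub t + phi *m M *m quo t + c *: (graph s phi *m Y).
  rewrite /Z /X mulmxDr -scalemxAr; congr (_ + _).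
  by rewrite mulmxDr !mulmxA graph_sub_proj quo_graph mul1mx.
have Zquo : Z *m quo_proj t = phi *m M + c *: (graph s phi *m Y *m quo_proj t).
  rewrite EZ 2!mulmxDl -scalemxAl -(mulmxA N) -(mulmxA (phi *m M)).
  by rewrite sub_quo0 quo_quoK mulmx0 mulmx1 add0r.
have Zsub : Z *m sub_proj t = N + c *: (graph s phi *m Y *m sub_proj t).
  rewrite EZ 2!mulmxDl -scalemxAl -(mulmxA N) -(mulmxA (phi *m M)).
  by rewrite quo_sub0 sub_subK mulmx0 mulmx1 addr0.
have Zpsi : Z *m quo_proj t = Z *m sub_proj t *m psi.
  apply/eqP; rewrite -subr_eq0 Zquo Zsub (mulmxDl N) -scalemxAl opprD addrACA.
  by rewrite -scalerBr -eqphi addrC subrKA subrr.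
by rewrite mulmxDr -[LHS]mulmx1 -(frame_sum t) mulmxDr !mulmxA Zpsi.
Qed.

(** * Subrepresentations of dimension e *)

Lemma congmx_graph (k : comNzRingType) (n m p x : nat)
    (f : frame (series k) m p x) phi psi :
  congmx n phi psi -> congmx n (graph f phi) (graph f psi).
Proof.
move=> phipsi; apply: congmxD; first exact: congmx_refl.
by apply: congmxM => //; apply: congmx_refl.
Qed.

Lemma partial_hom_graph (A : comNzRingType) (K k : fieldType)
    (j : {rmorphism A -> K}) (g : {rmorphism A -> k}) :
  injective j -> partial_hom [set u | exists a, u = (j a, g a)]%classic.
Proof.
move=> inj_j; split.
- by exists 1; rewrite !rmorph1.
- by move=> _ _ [a ->] [b ->]; exists (a - b); rewrite !rmorphB.
- by move=> _ _ [a ->] [b ->]; exists (a * b); rewrite !rmorphM.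
- move=> y [a [/esym ja ->]]; have -> : a = 0 by apply: inj_j; rewrite rmorph0.
  exact: rmorph0.
Qed.

Definition laurent_of_poly (k : fieldType) :
    {rmorphism {poly k} -> {fraction series k}} :=
  @tofrac (series k) \o @series_of_poly k.

Lemma laurent_of_poly_inj (k : fieldType) : injective (laurent_of_poly k).
Proof. by move=> p q /eqP; rewrite tofrac_eq => /eqP/series_of_poly_inj. Qed.

Lemma subrep_of_ext0 (k : closedFieldType) (Q : quiver) (d e : dimvec Q)
    (X : rep k (d + e)) :
  ext k e d = 0 ->
  exists f : forall i, 'M[k]_(e i, (d + e)%R i),
    (forall i, row_free (f i)) /\
    (forall a, (f (src a) *m X a <= f (tgt a))%MS).
Proof.
case/ext0_defect_surj => N [M surj].
have dims i : (e i + d i = (d + e)%R i)%N by rewrite ffunE addnC.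
pose fr i := frame_of_sum k (dims i).
pose Y a := X a - dsum_mx (fr (src a)) (fr (tgt a)) (N a) (M a).
pose cst := const_series k.
pose frs i := map_frame cst (fr i).
pose Ys a := map_mx cst (Y a).
pose rhs (phi : forall i, 'M[series k]_(e i, d i)) a :=
  graph (frs (src a)) (phi (src a)) *m Ys a *m quo_proj (frs (tgt a))
  - graph (frs (src a)) (phi (src a)) *m Ys a *m sub_proj (frs (tgt a))
    *m phi (tgt a).
have [n phi psi phipsi a|phi phiE] := solve_deformation (rhs := rhs) surj.
  have graphY : congmx n (graph (frs (src a)) (phi (src a)) *m Ys a)
                         (graph (frs (src a)) (psi (src a)) *m Ys a).
    by apply: congmxM; [apply: congmx_graph | apply: congmx_refl].
  have reflY m p (B : 'M[series k]_(m, p)) : congmx n B B by exact: congmx_refl.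
  exact (congmxD (congmxM graphY (reflY _ _ _))
    (congmxN (congmxM (congmxM graphY (reflY _ _ _)) (phipsi (tgt a))))).
pose K := {fraction series k}.
pose frac : {rmorphism series k -> K} := @tofrac (series k).
(* The line from the direct sum at t = 0 to X at t = 1. *)
pose Xt a : 'M[{poly k}]_((d + e)%R (src a), (d + e)%R (tgt a)) :=
  map_mx polyC (dsum_mx (fr (src a)) (fr (tgt a)) (N a) (M a))
  + 'X *: map_mx polyC (Y a).
have XtE a : map_mx (@series_of_poly k) (Xt a) =
    dsum_mx (frs (src a)) (frs (tgt a)) (map_mx cst (N a)) (map_mx cst (M a))
    + series_of_poly 'X *: Ys a.
  rewrite map_mxD map_mxZ -!map_mx_comp; congr (_ + _).
  by rewrite map_mxD !map_mxM.
pose f i := map_mx frac (graph (frs i) (phi i)).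
have f_free i : row_free (f i).
  apply/row_freeP; exists (map_mx frac (sub_proj (frs i))).
  by rewrite -map_mxM graph_sub_proj map_mx1.
have f_sub a : (f (src a) *m map_mx (laurent_of_poly k) (Xt a) <= f (tgt a))%MS.
  have -> : map_mx (laurent_of_poly k) (Xt a) =
      map_mx frac (map_mx (@series_of_poly k) (Xt a)) by rewrite -map_mx_comp.
  by rewrite -map_mxM XtE (graph_stable (phiE a)) map_mxM submxMl.
have at1 : injective (laurent_of_poly k) := @laurent_of_poly_inj k.
(* A place of K extending the evaluation of polynomials at t = 1. *)
have [|G [hG G0G valG]] := chevalley_extension
  (partial_hom_graph (horner_eval (1 : k)) at1).
  move=> c; exists (laurent_of_poly k c%:P), c%:P.
  by rewrite /= /horner_eval hornerC.
apply: (specialise_subrep hG valG _ f_free f_sub) => a p q.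
apply: G0G; exists (Xt a p q); rewrite mxE; congr (_, _).
have -> : X a = dsum_mx (fr (src a)) (fr (tgt a)) (N a) (M a) + Y a.
  by rewrite /Y [RHS]addrC subrK.
by rewrite /= /horner_eval !mxE hornerD hornerM hornerX !hornerC mul1r.
Qed.

Theorem proposition5p2 (k : closedFieldType) (hk : [pchar k] =i pred0)
  (Q : quiver) (hQ : acyclic Q) (d e : dimvec Q) :
  ext k e d = 0 -> cstar (cR k hQ d) (cR k hQ e) = cR k hQ (d + e).
Proof.
move=> ext0; apply: eq_exist; rewrite /gstar /gR /=; congr existT.
apply/seteqP; split=> // X _.
have [f [f_free f_sub]] := subrep_of_ext0 X ext0.
have [M [N [g exact_fg]]] := sub_exact f_free f_sub.
by exists M, N; split=> //; exists f, g.
Qed.
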